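(* Let $T>0$, $I=[0,T]$, let $r\in\mathcal{C}(I)$, and let $\alpha_0>0$, $\gamma_0>0$, $\beta_0\ge 0$ and $0<\lambda_{\min}<\lambda_{\max}<\infty$. For $f\in\mathcal{C}(I)$ define $\Lambda_f:I\to[0,\infty)$ by $$\Lambda_f(s) := \lambda_{\min} + (\lambda_{\max}-\lambda_{\min})\,\frac{\tanh\bigl(\gamma_0|f(s)-r(s)|\bigr)}{1+\beta_0\int_0^s e^{-\alpha_0(s-\tau)}\tanh\bigl(\gamma_0|f(\tau)-r(\tau)|\bigr)\,d\tau},\qquad s\in I.$$ Then the following hold. (P1) For every $f\in\mathcal{C}(I)$ and every $s\in I$, $\lambda_{\min}\le\Lambda_f(s)\le\lambda_{\max}$. (P2) For any two $f,g\in\mathcal{C}(I)$, $$\|\Lambda_f-\Lambda_g\|_\infty\le L_\Lambda\|f-g\|_\infty,\qquad\text{where } L_\Lambda=(\lambda_{\max}-\lambda_{\min})\gamma_0\left(1+\frac{\beta_0(1-e^{-\alpha_0T})}{\alpha_0}\right).$$ (P3) For each $f\in\mathcal{C}(I)$, the function $s\mapsto\Lambda_f(s)$ is continuous on $I$, and consequently Lebesgue measurable. (P4) For the zero trajectory $f\equiv 0$, one has $\Lambda_0(s)\ge\lambda_{\min}>0$ for all $s\in I$.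
   Context: $\mathcal{C}(I)$ denotes the set of continuous functions $I\to\mathbb{R}$, and $\|h\|_\infty:=\sup_{t\in I}|h(t)|$. $\Lambda_0$ denotes $\Lambda_f$ with $f\equiv 0$. *)

(* Defs.v *)
From HB Require Import structures.
From mathcomp Require Import all_boot all_order all_algebra.
From mathcomp Require Import all_classical all_reals all_analysis.
From mathcomp Require Import measurable_realfun.

Set Implicit Arguments.
Unset Strict Implicit.
Unset Printing Implicit Defensive.

Import Order.TTheory GRing.Theory Num.Theory.
Import numFieldNormedType.Exports.

Local Open Scope classical_set_scope.
Local Open Scope ring_scope.

Definition tanh (R : realType) (x : R) : R :=
  (expR x - expR (- x)) / (expR x + expR (- x)).

(* Functions on [0, T] are represented by total functions R -> R, of which only
   the values on [0, T] matter: for s in [0, T], Lambda at s reads f and r on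
   [0, s] only. *)
Definition Lambda (R : realType) (alpha0 beta0 gamma0 lmin lmax : R)
    (r f : R -> R) (s : R) : R :=
  lmin + (lmax - lmin) *
    (tanh (gamma0 * `|f s - r s|) /
     (1 + beta0 *
        \int[@lebesgue_measure R]_(tau in `[0, s])
           (expR (- alpha0 * (s - tau)) * tanh (gamma0 * `|f tau - r tau|)))).

(* The supremum is taken in the extended reals, so that it is meaningful
   without a boundedness side condition; it is finite for h continuous on a
   nonempty compact I. *)
Definition sup_norm (R : realType) (I : set R) (h : R -> R) : \bar R :=
  ereal_sup [set (`|h t|)%:E | t in I].

(* The canonical sigma-algebra on R is the Borel one; here the domain carries
   its completion for the Lebesgue measure and the codomain the Borel sets. *)
Definition lebesgue_measurable_fun (R : realType) (D : set R) (h : R -> R) :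
    Prop :=
  measurable_fun
    (D : set (g_sigma_algebraType
                (completed_algebra_gen (@lebesgue_measure R))))
    (h : g_sigma_algebraType (completed_algebra_gen (@lebesgue_measure R)) ->
         measurableTypeR R).

(* Main.v *)
Require Import Defs.
From HB Require Import structures.
From mathcomp Require Import all_boot all_order all_algebra.
From mathcomp Require Import all_classical all_reals all_analysis.
From mathcomp Require Import measurable_realfun ring lra.

Import Order.TTheory GRing.Theory Num.Theory.
Import numFieldNormedType.Exports.

Local Open Scope classical_set_scope.
Local Open Scope ring_scope.

(** Put [u = tanh (gamma0 * |f - r|)], the stimulus, and
    [A = 1 + beta0 * m], the attenuation, where [m s] is the integral of
    [exp (- alpha0 * (s - tau)) * u tau] for [tau] from 0 to [s], so that
    [Lambda = lmin + (lmax - lmin) * (u / A)].  Since [0 <= u <= 1] and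
    [A >= 1], the quotient lies between 0 and 1, which gives the bounds
    ([Lambda_bounds]).

    For the Lipschitz estimate, let [M] bound [|f - g|] from 0 to [T].  As
    [tanh] is 1-Lipschitz ([tanh_lipschitz]), the stimuli differ by at most
    [gamma0 * M].  The memory [m] is linear in [u] with a positive kernel of
    mass [(1 - exp (- alpha0 * s)) / alpha0], hence the attenuations differ by
    at most [beta0 * gamma0 * M * (1 - exp (- alpha0 * T)) / alpha0]
    ([fading_memory_lipschitz]).  For numerators between 0 and 1 and
    denominators at least 1, the distance of two quotients is at most the sum
    of the distances of numerators and of denominators ([dist_quotient_le]);
    adding the two estimates gives the constant ([dist_Lambda_le]).

    Continuity reduces to that of [m], which is [exp (- alpha0 * s)] times an
    indefinite integral of a continuous function ([fading_memory_continuous]);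
    the denominator [A] does not vanish.  Continuity implies Borel, hence
    Lebesgue, measurability. *)

(** * The hyperbolic tangent *)

Lemma expR_addN_gt0 {R : realType} (x : R) : 0 < expR x + expR (- x).
Proof. by rewrite addr_gt0 ?expR_gt0. Qed.

Lemma tanh_ge0 {R : realType} (x : R) : 0 <= x -> 0 <= tanh x.
Proof.
move=> x0; rewrite /tanh divr_ge0 ?(ltW (expR_addN_gt0 x))//.
by rewrite subr_ge0 ler_expR; lra.
Qed.

Lemma tanh_le1 {R : realType} (x : R) : tanh x <= 1.
Proof.
rewrite /tanh ler_pdivrMr ?expR_addN_gt0// mul1r.
by have := expR_gt0 (- x); lra.
Qed.

Lemma is_derive_tanh {R : realType} (x : R) :
  is_derive x 1 (@tanh R) (4 / (expR x + expR (- x)) ^+ 2).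
Proof.
have c0 : expR x + expR (- x) != 0 by rewrite gt_eqF ?expR_addN_gt0.
have dN : is_derive x 1 (fun y : R => expR (- y)) (expR (- x) * -1).
  exact: (@is_derive1_comp R expR (fun y => - y)).
have dV := @is_deriveV _ (fun y : R => expR y + expR (- y)) x _ 1 c0
  (is_deriveD (is_derive_expR x) dN).
have dM := is_deriveM (is_deriveB (is_derive_expR x) dN) dV.
apply: (is_derive_eq dM).
rewrite /= /GRing.scale/= !mulrN1 !fctE.
have -> : 4 = 4 * (expR x * expR (- x)) :> R by rewrite expRxMexpNx_1 mulr1.
by field.
Qed.

(** The derivative is the inverse square of the hyperbolic cosine, which is at
    most 1 by the arithmetic-geometric mean inequality for two reciprocal
    exponentials. *)
Lemma tanh_lipschitz {R : realType} (x y : R) :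
  `|tanh x - tanh y| <= `|x - y|.
Proof.
wlog yx : x y / y <= x.
  by move=> H; case: (leP y x) => [/H//|/ltW /H]; rewrite distrC (distrC y).
have [|c _ ->] := @MVT_segment R (@tanh R) _ y x yx
    (fun z _ => is_derive_tanh z).
  apply: derivable_within_continuous => z _.
  exact: (@ex_derive _ _ _ _ _ _ _ (is_derive_tanh z)).
rewrite normrM ler_piMl// ger0_norm; last first.
  by rewrite divr_ge0// sqr_ge0.
rewrite ler_pdivrMr ?exprn_gt0 ?expR_addN_gt0// mul1r.
have := expRxMexpNx_1 c.
by have := sqr_ge0 (expR c - expR (- c)); nra.
Qed.

Lemma continuous_tanh {R : realType} : continuous (@tanh R).
Proof.
move=> z; apply: differentiable_continuous; apply/derivable1_diffP.
exact: (@ex_derive _ _ _ _ _ _ _ (is_derive_tanh z)).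
Qed.

(** * Continuity on a segment *)

Lemma within_continuousM {R : realType} (A : set R) (u v : R -> R) :
  {within A, continuous u} -> {within A, continuous v} ->
  {within A, continuous (fun x => u x * v x)}.
Proof. by move=> cu cv x; apply: cvgM; [exact: cu|exact: cv]. Qed.

Lemma within_continuous_integrable {R : realType} (a b : R) (u : R -> R) :
  {within `[a, b], continuous u} ->
  (@lebesgue_measure R).-integrable `[a, b] (EFin \o u).
Proof.
move=> cu; apply: continuous_compact_integrable => //.
exact: segment_compact.
Qed.

(** Borel sets belong to the completed sigma-algebra: each is its own union
    with the negligible empty set. *)
Lemma within_continuous_lebesgue_measurable {R : realType} (a b : R)
    (h : R -> R) :
  {within `[a, b], continuous h} -> lebesgue_measurable_fun `[a, b] h.
Proof.
move=> ch; rewrite /lebesgue_measurable_fun => _ B mB.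
have mh : measurable_fun (`[a, b] : set (measurableTypeR R)) h.
  by apply: subspace_continuous_measurable_fun.
apply: sub_sigma_algebra; exists (`[a, b] `&` h @^-1` B); first exact: mh.
by exists set0; [exact: negligible_set0|rewrite setU0].
Qed.

(** * Exponentially fading memory *)

Definition fading_memory {R : realType} (a : R) (u : R -> R) (s : R) : R :=
  \int[@lebesgue_measure R]_(tau in `[0, s]) (expR (- a * (s - tau)) * u tau).

Lemma fading_kernel_continuous {R : realType} (a s : R) :
  continuous (fun tau : R => expR (- a * (s - tau))).
Proof.
move=> x; apply: (@continuous_comp _ _ _ (fun tau => - a * (s - tau)) expR).
  by apply: cvgM; [exact: cvg_cst|apply: cvgB; [exact: cvg_cst|exact: cvg_id]].
exact: continuous_expR.
Qed.

Lemma fading_memory_integrable {R : realType} (a s : R) (u : R -> R) :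
  {within `[0, s], continuous u} ->
  (@lebesgue_measure R).-integrable `[0, s]
    (EFin \o (fun tau => expR (- a * (s - tau)) * u tau)).
Proof.
move=> cu; apply: within_continuous_integrable.
apply: within_continuousM => //.
by apply: continuous_subspaceT; exact: fading_kernel_continuous.
Qed.

Lemma fading_memory_ge0 {R : realType} (a s : R) (u : R -> R) :
  (forall t, 0 <= u t) -> 0 <= fading_memory a u s.
Proof.
by move=> u0; apply: Rintegral_ge0 => t _; rewrite mulr_ge0 ?expR_ge0.
Qed.

(** For [M = 1] this is the mass of the kernel, from which the dependence of
    the Lipschitz constant on the final time comes. *)
Lemma fading_memory_cst {R : realType} (a s M : R) : 0 < a -> 0 <= s ->
  fading_memory a (fun=> M) s = M * ((1 - expR (- a * s)) / a).
Proof.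
move=> a0; rewrite le_eqVlt => /predU1P[<-|s0].
  rewrite /fading_memory set_itv1 Rintegral_set1.
  by rewrite mulr0 expR0 subrr mul0r mulr0.
pose F (tau : R) := M / a * expR (- a * (s - tau)).
have dF (t : R) : is_derive t 1 F (expR (- a * (s - t)) * M).
  have dl : is_derive t 1 (fun y : R => - a * (s - y)) a.
    apply: is_derive_eq.
    rewrite /GRing.scale/=.
    rewrite !(mulr0, addr0, sub0r, add0r, mulrN1, mulNr, mulr1, opprK); ring.
  have dc := @is_derive1_comp R expR (fun y => - a * (s - y)) t _ _
    (is_derive_expR _) dl.
  apply: (is_derive_eq (is_deriveZ (M / a) dc)).
  by rewrite /= /GRing.scale/=; field; rewrite gt_eqF.
have cF : continuous F.
  move=> t; apply: differentiable_continuous; apply/derivable1_diffP.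
  exact: (@ex_derive _ _ _ _ _ _ _ (dF t)).
rewrite /fading_memory /Rintegral (@continuous_FTC2 _ _ F)//.
- rewrite /= /F subrr mulr0 expR0 subr0; field.
  by rewrite gt_eqF.
- apply: within_continuousM.
    exact/continuous_subspaceT/fading_kernel_continuous.
  by apply: continuous_subspaceT => x; exact: cvg_cst.
- split; first by move=> t _; exact: (@ex_derive _ _ _ _ _ _ _ (dF t)).
  + exact/cvg_at_right_filter/cF.
  + exact/cvg_at_left_filter/cF.
- by move=> t _; rewrite derive1E; exact: (@derive_val _ _ _ _ _ _ _ (dF t)).
Qed.

(** Positivity of the kernel allows the distance of the inputs to be replaced
    by its bound [M] under the integral. *)
Lemma fading_memory_lipschitz {R : realType} (a s M : R) (u v : R -> R) :
  0 < a -> 0 <= s ->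
  {within `[0, s], continuous u} -> {within `[0, s], continuous v} ->
  (forall t, t \in `[0, s] -> `|u t - v t| <= M) ->
  `|fading_memory a u s - fading_memory a v s| <=
    M * ((1 - expR (- a * s)) / a).
Proof.
move=> a0 s0 cu cv uvM; rewrite -fading_memory_cst//.
have iu := fading_memory_integrable a _ _ cu.
have iv := fading_memory_integrable a _ _ cv.
have cuv : {within `[0, s], continuous (fun t => u t - v t)}.
  exact: (within_continuousB cu cv).
rewrite /fading_memory -RintegralB//.
under eq_Rintegral do rewrite -mulrBr.
have iuv := fading_memory_integrable a _ _ cuv.
apply: le_trans (le_normr_Rintegral _ iuv) _ => //.
apply: le_Rintegral => //.
- exact: (integrable_norm iuv).
- apply: fading_memory_integrable.
  by apply: continuous_subspaceT => x; exact: cvg_cst.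
- move=> t st; rewrite normrM (ger0_norm (expR_ge0 _)).
  by rewrite ler_wpM2l ?expR_ge0 ?uvM.
Qed.

(** Splitting the kernel as a product moves the variable [s] out of the
    integrand, so that only an indefinite integral remains. *)
Lemma fading_memory_continuous {R : realType} (a T : R) (u : R -> R) :
  0 <= T -> {within `[0, T], continuous u} ->
  {within `[0, T], continuous (fading_memory a u)}.
Proof.
move=> T0 cu.
pose w t := expR (a * t) * u t.
have cexp b : continuous (fun t : R => expR (b * t)).
  move=> x; apply: (@continuous_comp _ _ _ (fun t => b * t) expR).
    by apply: cvgM; [exact: cvg_cst|exact: cvg_id].
  exact: continuous_expR.
have cw : {within `[0, T], continuous w}.
  by apply: within_continuousM => //; exact/continuous_subspaceT/cexp.
have eqM : {in `[0, T]%classic, (fun s => expR (- a * s) *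
    parameterized_integral (@lebesgue_measure R) 0 s w) =1 fading_memory a u}.
  move=> s; rewrite inE/= in_itv/= => /andP[s0 sT].
  rewrite /parameterized_integral /fading_memory -RintegralZl//.
    apply: eq_Rintegral => t _; rewrite /w mulrA -expRD.
    by congr (expR _ * _); ring.
  apply: within_continuous_integrable; apply: continuous_subspaceW cw.
  by apply: subset_itvl; rewrite bnd_simp.
apply: (subspace_eq_continuous eqM).
apply: within_continuousM; first exact/continuous_subspaceT/cexp.
apply: parameterized_integral_continuous => //.
exact: within_continuous_integrable.
Qed.

(** * Bounds, continuity and Lipschitz estimate for Lambda *)

(** Write the difference as [(u - v) / P + (v / Q) * ((Q - P) / P)]; dividing by
    [P] does not increase absolute values, and [v / Q] is at most 1. *)
Lemma dist_quotient_le {R : realType} (u v P Q : R) :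
  0 <= v <= 1 -> 1 <= P -> 1 <= Q ->
  `|u / P - v / Q| <= `|u - v| + `|P - Q|.
Proof.
move=> /andP[v0 v1] P1 Q1.
have P0 : 0 < P by lra.
have Q0 : 0 < Q by lra.
have -> : u / P - v / Q = (u - v) / P + (v / Q) * ((Q - P) / P).
  by field; rewrite !gt_eqF.
have invP : `|P^-1| <= 1 by rewrite ger0_norm ?invr_ge0 ?(ltW P0)// invf_le1.
apply: le_trans (ler_normD _ _) _; apply: lerD.
  by rewrite normrM ler_piMr.
apply: (@le_trans _ _ `|(Q - P) / P|).
  rewrite normrM ler_piMl// ger0_norm ?divr_ge0 ?(ltW Q0)//.
  by rewrite ler_pdivrMr//; lra.
by rewrite normrM (distrC P) ler_piMr.
Qed.

Section Lambda.
Context {R : realType} (alpha0 beta0 gamma0 lmin lmax T : R) (r : R -> R).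
Hypotheses (T_gt0 : 0 < T) (r_cont : {within `[0, T], continuous r})
  (alpha0_gt0 : 0 < alpha0) (gamma0_gt0 : 0 < gamma0) (beta0_ge0 : 0 <= beta0)
  (lmin_lt_lmax : lmin < lmax).

Definition stimulus (f : R -> R) (t : R) : R := tanh (gamma0 * `|f t - r t|).

Definition attenuation (f : R -> R) (s : R) : R :=
  1 + beta0 * fading_memory alpha0 (stimulus f) s.

Local Notation Lam := (Lambda alpha0 beta0 gamma0 lmin lmax r).

Lemma LambdaE (f : R -> R) (s : R) :
  Lam f s = lmin + (lmax - lmin) * (stimulus f s / attenuation f s).
Proof. by []. Qed.

Lemma stimulus_ge0 f t : 0 <= stimulus f t.
Proof. by rewrite tanh_ge0// mulr_ge0// ltW. Qed.

Lemma stimulus_le1 f t : stimulus f t <= 1.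
Proof. exact: tanh_le1. Qed.

Lemma attenuation_ge1 f s : 1 <= attenuation f s.
Proof.
by rewrite lerDl mulr_ge0// fading_memory_ge0// => t; exact: stimulus_ge0.
Qed.

Lemma Lambda_bounds f s : lmin <= Lam f s <= lmax.
Proof.
have A1 := attenuation_ge1 f s.
have A0 : 0 < attenuation f s by lra.
have q0 : 0 <= stimulus f s / attenuation f s.
  by rewrite divr_ge0 ?stimulus_ge0// ltW.
have q1 : stimulus f s / attenuation f s <= 1.
  by rewrite ler_pdivrMr// mul1r (le_trans (stimulus_le1 f s)).
rewrite LambdaE; move: q0 q1; set q := _ / _ => q0 q1.
by apply/andP; split; move: lmin_lt_lmax; nra.
Qed.

Lemma stimulus_continuous f : {within `[0, T], continuous f} ->
  {within `[0, T], continuous (stimulus f)}.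
Proof.
move=> cf x; have cB := within_continuousB cf r_cont.
apply: (@cvg_comp _ _ _ (fun t => gamma0 * `|f t - r t|) (@tanh R)); last first.
  exact: continuous_tanh.
by apply: cvgM; [exact: cvg_cst|apply: cvg_norm; exact: cB].
Qed.

Lemma attenuation_continuous f : {within `[0, T], continuous f} ->
  {within `[0, T], continuous (attenuation f)}.
Proof.
move=> cf x; have cm := fading_memory_continuous alpha0 _ _ (ltW T_gt0)
  (stimulus_continuous _ cf).
by apply: cvgD; [exact: cvg_cst|apply: cvgM; [exact: cvg_cst|exact: cm]].
Qed.

Lemma Lambda_continuous f : {within `[0, T], continuous f} ->
  {within `[0, T], continuous (Lam f)}.
Proof.
move=> cf x.
have -> : Lam f =
    fun s => lmin + (lmax - lmin) * (stimulus f s / attenuation f s).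
  by apply/funext => s; exact: LambdaE.
apply: cvgD; first exact: cvg_cst.
apply: cvgM; first exact: cvg_cst.
apply: cvgM; first exact: stimulus_continuous.
apply: cvgV; last exact: attenuation_continuous.
by rewrite gt_eqF// (lt_le_trans ltr01)// attenuation_ge1.
Qed.

Lemma dist_stimulus_le f g t :
  `|stimulus f t - stimulus g t| <= gamma0 * `|f t - g t|.
Proof.
apply: le_trans (tanh_lipschitz _ _) _.
rewrite -mulrBr normrM (gtr0_norm gamma0_gt0) ler_wpM2l ?(ltW gamma0_gt0)//.
apply: le_trans (ler_dist_dist _ _) _.
by rewrite opprB addrA subrK.
Qed.

(** Both the stimulus and, through the memory, the attenuation are Lipschitz
    in the trajectory; the first gives the summand 1 of the constant, the second
    the summand [beta0 * (1 - expR (- alpha0 * T)) / alpha0]. *)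
Lemma dist_Lambda_le f g (M s : R) :
  {within `[0, T], continuous f} -> {within `[0, T], continuous g} ->
  (forall t, t \in `[0, T] -> `|f t - g t| <= M) -> s \in `[0, T] ->
  `|Lam f s - Lam g s| <= (lmax - lmin) * gamma0 *
     (1 + beta0 * (1 - expR (- alpha0 * T)) / alpha0) * M.
Proof.
move=> cf cg fgM; rewrite in_itv/= => /andP[s0 sT].
have sub : `[0, s] `<=` `[0, T] by apply: subset_itvl; rewrite bnd_simp.
have cu h : {within `[0, T], continuous h} ->
    {within `[0, s], continuous (stimulus h)}.
  by move=> ch; apply: continuous_subspaceW sub _; exact: stimulus_continuous.
have M0 : 0 <= M.
  by apply: le_trans (fgM 0 _); rewrite ?normr_ge0// in_itv/= lexx ltW.
have dm : `|fading_memory alpha0 (stimulus f) s -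
            fading_memory alpha0 (stimulus g) s| <=
          gamma0 * M * ((1 - expR (- alpha0 * s)) / alpha0).
  apply: fading_memory_lipschitz => // [||t ts]; [exact: cu|exact: cu|].
  apply: le_trans (dist_stimulus_le _ _ _) _.
  by rewrite ler_wpM2l ?(ltW gamma0_gt0)// fgM//; exact: sub.
have dsT : (1 - expR (- alpha0 * s)) / alpha0 <=
           (1 - expR (- alpha0 * T)) / alpha0.
  rewrite ler_pM2r ?invr_gt0// lerB// ler_expR !mulNr lerN2.
  by rewrite ler_wpM2l ?(ltW alpha0_gt0).
have du : `|stimulus f s - stimulus g s| <= gamma0 * M.
  apply: le_trans (dist_stimulus_le _ _ _) _.
  by rewrite ler_wpM2l ?(ltW gamma0_gt0)// fgM// in_itv/= s0.
have dA : `|attenuation f s - attenuation g s| <=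
          beta0 * (gamma0 * M * ((1 - expR (- alpha0 * T)) / alpha0)).
  rewrite /attenuation opprD addrACA subrr add0r -mulrBr normrM.
  rewrite (ger0_norm beta0_ge0) ler_wpM2l//; apply: le_trans dm _.
  by rewrite ler_wpM2l// mulr_ge0// ltW.
rewrite !LambdaE opprD addrACA subrr add0r -mulrBr normrM.
rewrite ger0_norm ?subr_ge0 ?(ltW lmin_lt_lmax)// -2![leRHS]mulrA.
rewrite ler_wpM2l ?subr_ge0 ?(ltW lmin_lt_lmax)//.
apply: le_trans (dist_quotient_le _ _ _ _ _ (attenuation_ge1 f s)
  (attenuation_ge1 g s)) _.
  by rewrite stimulus_ge0 stimulus_le1.
apply: le_trans (lerD du dA) _.
by rewrite le_eqVlt; apply/orP; left; apply/eqP; ring.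
Qed.

End Lambda.

Theorem theorem3p1 (R : realType) (T : R) (r : R -> R)
    (alpha0 gamma0 beta0 lmin lmax : R)
    (T_gt0 : 0 < T)
    (r_cont : {within `[0, T], continuous r})
    (alpha0_gt0 : 0 < alpha0) (gamma0_gt0 : 0 < gamma0) (beta0_ge0 : 0 <= beta0)
    (lmin_gt0 : 0 < lmin) (lmin_lt_lmax : lmin < lmax) :
  let Lam := Lambda alpha0 beta0 gamma0 lmin lmax r in
  let L := (lmax - lmin) * gamma0 *
           (1 + beta0 * (1 - expR (- alpha0 * T)) / alpha0) in
  [/\ (forall f : R -> R, {within `[0, T], continuous f} ->
         forall s : R, s \in `[0, T] -> lmin <= Lam f s /\ Lam f s <= lmax),
      (forall f g : R -> R,
         {within `[0, T], continuous f} -> {within `[0, T], continuous g} ->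
         (sup_norm `[0%R, T] (fun s => (Lam f s - Lam g s)%R) <=
            L%:E * sup_norm `[0%R, T] (fun s => (f s - g s)%R))%E),
      (forall f : R -> R, {within `[0, T], continuous f} ->
         {within `[0, T], continuous (Lam f)} /\
         lebesgue_measurable_fun `[0, T] (Lam f)) &
      (forall s : R, s \in `[0, T] ->
         lmin <= Lam (fun _ : R => 0) s /\ 0 < lmin)].
Proof.
move=> Lam L.
split=> [f cf s sT|f g cf cg|f cf|s sT].
- by apply/andP; exact: Lambda_bounds.
- have L0 : 0 < L.
    rewrite /L; apply: mulr_gt0; first by rewrite mulr_gt0// subr_gt0.
    rewrite ltr_pwDl// divr_ge0 ?(ltW alpha0_gt0)// mulr_ge0// subr_ge0.
    by rewrite -expR0 ler_expR mulNr oppr_le0 mulr_ge0// ltW.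
  set N := sup_norm _ (fun s => f s - g s).
  have fgN t : t \in `[0, T] -> ((`|f t - g t|)%:E <= N)%E.
    by move=> tT; apply: ereal_sup_ubound; exists t.
  have N0 : (0 <= N)%E.
    by apply: le_trans (fgN 0 _); rewrite ?lee_fin// in_itv/= lexx ltW.
  apply: ge_ereal_sup => _ [s sT <-].
  (* As [L] is positive, an infinite norm of [f - g] makes the right-hand side
     infinite. *)
  move: N0 fgN; case: N => [M| |] //= _ fgM; last first.
    by rewrite gt0_muley ?leey ?lte_fin.
  by rewrite -EFinM lee_fin; apply: dist_Lambda_le.
- have cLam : {within `[0, T], continuous (Lam f)} by exact: Lambda_continuous.
  by split => //; exact: within_continuous_lebesgue_measurable.
- have /andP[-> _] : lmin <= Lam (fun=> 0) s <= lmax by exact: Lambda_bounds.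
  by [].
Qed.
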